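(* Let $\{(X_i,\mathcal U_i):i\in I\}$ be a family of $g$-quasi uniform spaces with $I\neq\emptyset$, and let $(X,\mathcal U)$ be its product $g$-quasi uniform space. If $(X,\mathcal U)$ is sequentially Lebesgue, then $(X_i,\mathcal U_i)$ is sequentially Lebesgue for each $i\in I$.
   Context: A $g$-quasi uniformity (generalized quasi-uniformity) on a nonempty set $Z$ is a nonempty collection $\mathcal V\subset\mathcal P(Z\times Z)$ such that (i) $\Delta(Z)=\{(z,z):z\in Z\}\subset U$ for all $U\in\mathcal V$; (ii) $U\in\mathcal V$ and $U\subset V\subset Z\times Z$ imply $V\in\mathcal V$; (iii) for each $U\in\mathcal V$ there is $V\in\mathcal V$ with $V\circ V\subset U$, where $V\circ V=\{(x,z):\exists y,\ (x,y)\in V,(y,z)\in V\}$. (Closure under intersection is not required.) The pair $(Z,\mathcal V)$ is called a $g$-quasi uniform space. Product: for a family $\{(X_i,\mathcal U_i):i\in I\}$ of $g$-quasi uniform spaces, let $X=\prod_{i\in I}X_i$ with projections $\pi_i:X\to X_i$. The product $g$-quasi uniformity $\mathcal U$ on $X$ is the one with base $\{(\pi_i\times\pi_i)^{-1}(U_i):U_i\in\mathcal U_i,\ i\in I\}$, i.e. $\mathcal U=\{V\subset X\times X: (\pi_i\times\pi_i)^{-1}(U_i)\subset V\text{ for some }i\in I,\ U_i\in\mathcal U_i\}$ (no finite intersections are taken). $(X,\mathcal U)$ is the product $g$-quasi uniform space. For $U\in\mathcal V$ and $x\in Z$ put $U(x)=\{y\in Z:(x,y)\in U\}$. The collection $\mu(\mathcal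 V)=\{G\subset Z: \text{for every }x\in G\text{ there is }U\in\mathcal V\text{ with }U(x)\subset G\}$ is the induced supratopology. A generalized neighborhood of $a\in Z$ is a set $A\subset Z$ with $a\in G\subset A$ for some $G\in\mu(\mathcal V)$. Let $(x_n)_{n\in\mathbb N}$ be a sequence in $Z$. A point $c\in Z$ is a cluster point of $(x_n)$ if for every generalized neighborhood $A$ of $c$ and every $n\in\mathbb N$ there is $m\ge n$ with $x_m\in A$. The sequence is pseudo-Cauchy if for every $U\in\mathcal V$ and $p\in\mathbb N$ there exist $m\neq n$ in $\mathbb N$ with $m,n\ge p$ and $(x_m,x_n)\in U$. $(Z,\mathcal V)$ is sequentially Lebesgue if every pseudo-Cauchy sequence in $Z$ having distinct terms (i.e. $x_m\ne x_n$ for all $m\ne n$) has a cluster point in $Z$. *)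

(* Defs.v *)
From mathcomp Require Import all_boot.
From mathcomp Require Import mathcomp_extra boolp classical_sets.

Set Implicit Arguments.
Unset Strict Implicit.
Unset Printing Implicit Defensive.

Local Open Scope classical_set_scope.

(* [B \; A] relates x to z when (x, y) \in A and (y, z) \in B for some y. *)
Record is_gquasi_uniformity (Z : Type) (V : set_system (Z * Z)) : Prop :=
  IsGQuasiUniformity {
    gqu_carrier_nonempty : inhabited Z;
    gqu_nonempty : V !=set0;
    gqu_diagonal : forall U, V U -> diagonal `<=` U;
    gqu_upward : forall U W, V U -> U `<=` W -> V W;
    gqu_split : forall U, V U -> exists2 W, V W & (W \; W)%relation `<=` U
  }.

(* (pi_i x pi_i)^-1(W) *)
Definition proj_preimage (I : Type) (X : I -> Type) (i : I)
    (W : set (X i * X i)) : set ((forall j, X j) * (forall j, X j)) :=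
  (fun p => (proj i p.1, proj i p.2)) @^-1` W.

Definition product_gqu (I : Type) (X : I -> Type)
    (U : forall i, set_system (X i * X i)) :
    set_system ((forall i, X i) * (forall i, X i)) :=
  [set V | exists i, exists2 W, U i W & proj_preimage W `<=` V].

Definition supratopology (Z : Type) (V : set_system (Z * Z)) : set_system Z :=
  [set G | forall x, G x -> exists2 U, V U & xsection U x `<=` G].

Definition gneighborhood (Z : Type) (V : set_system (Z * Z)) (a : Z) :
    set_system Z :=
  [set A | exists G, [/\ supratopology V G, G a & G `<=` A]].

Definition cluster_point (Z : Type) (V : set_system (Z * Z)) (x : nat -> Z)
    (c : Z) : Prop :=
  forall A, gneighborhood V c A -> forall n, exists2 m, n <= m & A (x m).

Definition pseudo_cauchy (Z : Type) (V : set_system (Z * Z)) (x : nat -> Z) :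
    Prop :=
  forall U, V U -> forall p : nat,
    exists m n : nat, [/\ m <> n, p <= m, p <= n & U (x m, x n)].

Definition sequentially_lebesgue (Z : Type) (V : set_system (Z * Z)) : Prop :=
  forall x : nat -> Z, injective x -> pseudo_cauchy V x ->
    exists c, cluster_point V x c.

Lemma product_gqu_is_gquasi_uniformity (I : Type) (X : I -> Type)
    (U : forall i, set_system (X i * X i)) :
  inhabited I -> (forall i, is_gquasi_uniformity (U i)) ->
  is_gquasi_uniformity (product_gqu U).
Proof.
move=> [i0] HU; split.
- have ne i : exists x : X i, True by case: (gqu_carrier_nonempty (HU i)) => x; exists x.
  exact: inhabits (fun i => sval (cid (ne i))).
- have [W UW] := gqu_nonempty (HU i0).
  by exists (proj_preimage W), i0, W.
- move=> V [i [W UW WV]] [x y] /= xy; apply: WV.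
  by apply: (gqu_diagonal (HU i) UW); rewrite /diagonal /= -[x]/((x, y).1) xy.
- move=> V V' [i [W UW WV]] VV'.
  by exists i, W => //; exact: subset_trans VV'.
- move=> V [i [W UW WV]].
  have [W' UW' W'W] := gqu_split (HU i) UW.
  exists (proj_preimage W'); first by exists i, W'.
  move=> [x z] /= [y xy yz]; apply: WV.
  by apply: W'W; exists (y i).
Qed.

(* Main.v *)
Require Import Defs.
From mathcomp Require Import all_boot.
From mathcomp Require Import mathcomp_extra boolp classical_sets.

(** Fix a factor [i] and a base point [b] of the product. Overwriting the
    [i]-th coordinate of [b] embeds [X i] as a slice of the product, and a
    sequence of [X i] is the [i]-th projection of its image in that slice.
    - The embedding preserves pseudo-Cauchy sequences
      ([pseudo_cauchy_slice]). As the product takes no finite intersections, a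
      basic entourage constrains one coordinate [j] only: for [j = i] this is
      the hypothesis on the given sequence, and for [j <> i] both points have
      the coordinate [b j], so that reflexivity of entourages suffices.
    - The projection maps cluster points to cluster points
      ([cluster_point_proj]), because it is continuous for the
      supratopologies.
    Hence a pseudo-Cauchy sequence with distinct terms in [X i] embeds, still
    with distinct terms, into the product; it has a cluster point there, whose
    [i]-th coordinate is a cluster point of the original sequence. *)

Local Open Scope classical_set_scope.

(** The index type carries no decidable equality, whereas [dfwith] compares
   indices; [{classic I}] is [I] with the equality decided classically. *)
Definition slice (I : Type) (X : I -> Type) (b : forall j, X j) (i : I)
    (a : X i) : forall j, X j :=
  @dfwith {classic I} X b i a.
Arguments slice {I X} b {i} a.

Lemma sliceE (I : Type) (X : I -> Type) (b : forall j, X j) (i : I) (a : X i) :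
  slice b a i = a.
Proof. exact: (@dfwithin {classic I}). Qed.

Lemma slice_neq (I : Type) (X : I -> Type) (b : forall j, X j) (i j : I)
    (a : X i) :
  i <> j -> slice b a j = b j.
Proof.
by move=> ij; apply: (@dfwithout {classic I}); apply/eqP.
Qed.

Lemma slice_inj (I : Type) (X : I -> Type) (b : forall j, X j) (i : I) :
  injective (fun a : X i => slice b a).
Proof. by move=> a a' /(congr1 (proj i)); rewrite /proj !sliceE. Qed.

Lemma pseudo_cauchy_slice (I : Type) (X : I -> Type)
    (U : forall i : I, set_system (X i * X i)) (b : forall j, X j) (i : I)
    (x : nat -> X i) :
  (forall j W, U j W -> diagonal `<=` W) ->
  pseudo_cauchy (U i) x ->
  pseudo_cauchy (product_gqu U) (fun n => slice b (x n)).
Proof.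
move=> Urefl xC V [j [W UW WV]] p.
have [ij|ij] := pselect (i = j).
  case: _ / ij W UW WV => W UW WV.
  have [m [n [mn pm pn Wx]]] := xC W UW p.
  exists m, n; split=> //; apply: WV.
  by rewrite /proj_preimage /= /proj !sliceE.
exists p, p.+1; split=> //.
by apply: WV; apply: (Urefl j W UW); rewrite /diagonal /= /proj !slice_neq.
Qed.

(** Continuity of the projections, in the form of preimages of open sets. *)
Lemma supratopology_proj (I : Type) (X : I -> Type)
    (U : forall i : I, set_system (X i * X i)) (i : I) (G : set (X i)) :
  supratopology (U i) G ->
  supratopology (product_gqu U) (proj i @^-1` G).
Proof.
move=> oG y /oG[W UW WG].
exists (proj_preimage W); first by exists i, W.
by move=> z /xsectionP Wyz; apply: WG; apply/xsectionP.
Qed.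

Lemma cluster_point_proj (I : Type) (X : I -> Type)
    (U : forall i : I, set_system (X i * X i)) (i : I)
    (y : nat -> forall j, X j) (c : forall j, X j) :
  cluster_point (product_gqu U) y c ->
  cluster_point (U i) (fun n => y n i) (c i).
Proof.
move=> yc A [G [oG Gc GA]] n.
have [|m nm Gm] := yc (proj i @^-1` G) _ n.
  by exists (proj i @^-1` G); split=> //; exact: supratopology_proj.
by exists m => //; exact: GA.
Qed.

Theorem theorem4p7 (I : Type) (X : I -> Type)
    (U : forall i : I, set_system (X i * X i))
    (I_nonempty : inhabited I)
    (U_gqu : forall i : I, is_gquasi_uniformity (U i))
    (prod_lebesgue : sequentially_lebesgue (product_gqu U)) :
  forall i : I, sequentially_lebesgue (U i).
Proof.
move=> i x x_inj xC.
have [b] := gqu_carrier_nonempty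
  (product_gqu_is_gquasi_uniformity I_nonempty U_gqu).
have [| |c yc] := prod_lebesgue (fun n => slice b (x n)).
- by move=> m n mn; apply: x_inj; exact: slice_inj mn.
- by apply: pseudo_cauchy_slice => // j W; exact: gqu_diagonal.
exists (c i); have := cluster_point_proj _ _ _ i _ _ yc.
by under eq_fun do rewrite sliceE.
Qed.
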